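(* Let $K\subset\mathbb{R}^n$ be an isotone projection cone generated by linearly independent vectors $b_1,\ldots,b_n$, and let $\bar x\in\mathbb{R}^n$. Then the Fréchet coderivative of the metric projection $P_K$ at $\bar x$ satisfies, for all $y\in\mathbb{R}^n$, $$\widehat D^*P_K(\bar x)(y)=\left\{z\in\mathbb{R}^n\;\middle|\;\begin{array}{ll}\langle z,b_i\rangle=\langle y,b_i\rangle & \forall i\in I^+_{\bar x},\\ \langle z,b_i\rangle\le\langle y,b_i\rangle & \forall i\in I^\bullet_{\bar x},\\ \langle z,u_j\rangle\le 0 & \forall j\in I^\bullet_{\bar x},\\ \langle z,u_j\rangle=0 & \forall j\in I^-_{\bar x}\end{array}\right\}.$$
   Context: $N=\{1,\ldots,n\}$ with $n\ge1$. For linearly independent $b_1,\ldots,b_n\in\mathbb{R}^n$, the cone generated by them is $K=\{\sum_{i=1}^n\alpha_i b_i\mid \alpha_i\ge 0\}$; the associated vectors $u_1,\ldots,u_n$ are determined by $\langle u_j,b_i\rangle=-\delta_{ij}$ (Kronecker delta). $P_K$ denotes the Euclidean metric projection onto $K$. $K$ is an isotone projection cone if for all $x,y$ with $y-x\in K$ one has $P_K(y)-P_K(x)\in K$; it is known that this is equivalent to $\langle u_j,u_k\rangle\le 0$ for all $j\neq k$. Index sets: it is known that for every $x\in\mathbb{R}^n$ there is a unique subset $I\subset N$ such that $x=\sum_{i\in N\setminus I}\alpha_i b_i+\sum_{j\in I}\beta_j u_j$ with $\beta_j>0$ for all $j\in I$ and $\alpha_i\ge0$ for all $i\in N\setminus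 I$ (the coefficients are then unique, and $P_K(x)=\sum_{i\in N\setminus I}\alpha_i b_i$). With this $I$, define $I_x^+:=\{i\in N\setminus I\mid\alpha_i>0\}$, $I_x^\bullet:=\{i\in N\setminus I\mid\alpha_i=0\}$, $I_x^-:=I$. Fréchet normal cone of $\Omega$ at $\bar w\in\Omega$: $\widehat N_\Omega(\bar w)=\{z\mid\limsup_{w\to\bar w,\,w\in\Omega}\langle z,w-\bar w\rangle/\|w-\bar w\|\le0\}$. Fréchet coderivative of a single-valued map $f:\mathbb{R}^n\to\mathbb{R}^n$: $\widehat D^*f(\bar x)(y)=\{z\in\mathbb{R}^n\mid(z,-y)\in\widehat N_{\operatorname{gph}f}(\bar x,f(\bar x))\}$, where $\operatorname{gph} f=\{(x,f(x))\}$. *)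

(* Defs.v *)
From HB Require Import structures.
From mathcomp Require Export all_boot all_order all_algebra.
From mathcomp Require Export all_classical all_reals all_analysis.
Set Implicit Arguments.
Unset Strict Implicit.
Unset Printing Implicit Defensive.
Export Order.TTheory GRing.Theory Num.Theory.
Export numFieldNormedType.Exports.

Local Open Scope classical_set_scope.
Local Open Scope ring_scope.

Definition dot (R : realType) (n : nat) (x y : 'rV[R]_n) : R :=
  \sum_(i < n) x 0 i * y 0 i.

(* The library norm on 'rV[R]_n is the sup norm; both norms induce the
   topology of 'rV[R]_n. *)
Definition enorm (R : realType) (n : nat) (x : 'rV[R]_n) : R :=
  Num.sqrt (dot x x).

Definition cone (R : realType) (n : nat) (b : 'I_n -> 'rV[R]_n) :
    set 'rV[R]_n :=
  [set x | exists2 a : 'I_n -> R,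
     forall i, 0 <= a i & x = \sum_(i < n) a i *: b i].

Definition is_proj (R : realType) (n : nat) (K : set 'rV[R]_n)
    (x p : 'rV[R]_n) : Prop :=
  K p /\ forall q, K q -> enorm (x - p) <= enorm (x - q).

(* The default value 0 is only used when x has no nearest point in K, which
   does not happen for a nonempty closed convex K. *)
Definition proj (R : realType) (n : nat) (K : set 'rV[R]_n)
    (x : 'rV[R]_n) : 'rV[R]_n :=
  xget 0 [set p | is_proj K x p].

Definition isotone_projection (R : realType) (n : nat)
    (K : set 'rV[R]_n) : Prop :=
  forall x y, K (y - x) -> K (proj K y - proj K x).

(* The components of a (resp. be) on I (resp. outside I) are irrelevant. *)
Definition is_decomp (R : realType) (n : nat) (b u : 'I_n -> 'rV[R]_n)
    (x : 'rV[R]_n) (I : {set 'I_n}) (a be : 'I_n -> R) : Prop :=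
  [/\ x = \sum_(i in ~: I) a i *: b i + \sum_(j in I) be j *: u j,
      forall j, j \in I -> 0 < be j
    & forall i, i \notin I -> 0 <= a i].

(* For linearly independent b and the associated u, the set I and the
   coefficients a outside I are uniquely determined by x. *)
Definition idx_pos (R : realType) (n : nat) (b u : 'I_n -> 'rV[R]_n)
    (x : 'rV[R]_n) : set 'I_n :=
  [set i | exists I a be, [/\ is_decomp b u x I a be, i \notin I & 0 < a i]].

Definition idx_zero (R : realType) (n : nat) (b u : 'I_n -> 'rV[R]_n)
    (x : 'rV[R]_n) : set 'I_n :=
  [set i | exists I a be, [/\ is_decomp b u x I a be, i \notin I & a i = 0]].

Definition idx_neg (R : realType) (n : nat) (b u : 'I_n -> 'rV[R]_n)
    (x : 'rV[R]_n) : set 'I_n :=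
  [set i | exists I a be, is_decomp b u x I a be /\ i \in I].

(* The limsup is taken over w in Omega with w != w0. If w0 is isolated in
   Omega the filter is improper, the limsup is -oo, and the cone is the whole
   space. *)
Definition frechet_normal (R : realType) (m : nat) (Omega : set 'rV[R]_m)
    (w0 : 'rV[R]_m) : set 'rV[R]_m :=
  [set z | (limf_esup (fun w : 'rV[R]_m => (dot z (w - w0) / enorm (w - w0))%:E)
                (within (Omega `\ w0) (nbhs w0)) <= 0)%E].

(* R^n x R^n is represented as 'rV[R]_(n + n), via row_mx, so that it carries
   the Euclidean structure of R^(2n). *)
Definition gph (R : realType) (n : nat) (f : 'rV[R]_n -> 'rV[R]_n) :
    set 'rV[R]_(n + n) :=
  [set row_mx x (f x) | x in setT].

Definition frechet_coderivative (R : realType) (n : nat)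
    (f : 'rV[R]_n -> 'rV[R]_n) (x y : 'rV[R]_n) : set 'rV[R]_n :=
  [set z | frechet_normal (gph f) (row_mx x (f x)) (row_mx z (- y))].

(* Main.v *)
(* Write [p] for the projection of [x] onto the cone. Since the [u i] are, up to
   sign, the dual basis of the [b i], the pair [(p, x - p)] is determined by the
   complementarity system [<p, u i> <= 0], [<x - p, b i> <= 0],
   [<p, u i> * <x - p, b i> = 0], and the three index sets record which factors
   vanish. Hence the graph of the projection contains short segments issued from
   [(x, p)] along [(b i, b i)] when [<x - p, b i> = 0] (in both directions when
   [<p, u i> < 0]) and along [(u i, 0)] when [<p, u i> = 0] (in both directions
   when [<x - p, b i> < 0]); these give the four conditions on [z]. Conversely,
   near [(x, p)] the strict inequalities persist, and expanding
   [<z, dx> - <y, dp> = <z - y, dp> + <z, dx - dp>] in dual coordinates makes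
   every term nonpositive. *)
Require Import Defs.
From mathcomp Require Import lra.

Set Implicit Arguments.
Unset Strict Implicit.

Local Open Scope classical_set_scope.
Local Open Scope ring_scope.

(** * Euclidean inner product: bilinearity, positivity, continuity *)

Section Dot.
Context {R : realType} {n : nat}.
Implicit Types (x y z : 'rV[R]_n) (t : R).

Lemma dotC x y : dot x y = dot y x.
Proof. by apply: eq_bigr => i _; rewrite mulrC. Qed.

Lemma dotDl x y z : dot (x + y) z = dot x z + dot y z.
Proof. by rewrite -big_split; apply: eq_bigr => i _; rewrite mxE mulrDl. Qed.

Lemma dotZl t x z : dot (t *: x) z = t * dot x z.
Proof. by rewrite mulr_sumr; apply: eq_bigr => i _; rewrite mxE mulrA. Qed.

Lemma dotNl x z : dot (- x) z = - dot x z.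
Proof. by rewrite -scaleN1r dotZl mulN1r. Qed.

Lemma dotBl x y z : dot (x - y) z = dot x z - dot y z.
Proof. by rewrite dotDl dotNl. Qed.

Lemma dot0l z : dot 0 z = 0.
Proof. by rewrite -(scale0r z) dotZl mul0r. Qed.

Lemma dot_suml (I : Type) (r : seq I) (P : pred I) (F : I -> 'rV[R]_n) z :
  dot (\sum_(i <- r | P i) F i) z = \sum_(i <- r | P i) dot (F i) z.
Proof.
exact: (big_morph (fun x => dot x z) (fun x y => dotDl x y z) (dot0l z)).
Qed.

Lemma dotDr x y z : dot z (x + y) = dot z x + dot z y.
Proof. by rewrite !(dotC z) dotDl. Qed.

Lemma dotZr t x z : dot z (t *: x) = t * dot z x.
Proof. by rewrite !(dotC z) dotZl. Qed.

Lemma dotNr x z : dot z (- x) = - dot z x.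
Proof. by rewrite !(dotC z) dotNl. Qed.

Lemma dotBr x y z : dot z (x - y) = dot z x - dot z y.
Proof. by rewrite !(dotC z) dotBl. Qed.

Lemma dot_ge0 x : 0 <= dot x x.
Proof. by apply: sumr_ge0 => i _; rewrite -expr2 sqr_ge0. Qed.

Lemma dot_eq0 x : dot x x = 0 -> x = 0.
Proof.
move/eqP; rewrite psumr_eq0 => [/allP x0|i _]; last by rewrite -expr2 sqr_ge0.
apply/rowP => i; rewrite mxE; apply/eqP.
by have := x0 i (mem_index_enum i); rewrite -expr2 sqrf_eq0.
Qed.

Lemma ler_enorm x y : (enorm x <= enorm y) = (dot x x <= dot y y).
Proof. by rewrite /enorm ler_sqrt ?dot_ge0. Qed.

Lemma enorm_gt0 x : x != 0 -> 0 < enorm x.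
Proof.
move=> x0; rewrite sqrtr_gt0 lt_neqAle dot_ge0 andbT eq_sym.
by apply: contra x0 => /eqP/dot_eq0 ->.
Qed.

Lemma enormZ t x : 0 <= t -> enorm (t *: x) = t * enorm x.
Proof.
move=> t0; rewrite /enorm dotZl dotZr mulrA -expr2 sqrtrM ?sqr_ge0 //.
by rewrite sqrtr_sqr ger0_norm.
Qed.

Lemma continuous_dot (T : topologicalType) (f g : T -> 'rV[R]_n) :
  continuous f -> continuous g -> continuous (fun w => dot (f w) (g w)).
Proof.
move=> cf cg w; rewrite /dot; apply: cvg_big => [|i _].
  by move=> p; apply: cvgD; [exact: cvg_fst|exact: cvg_snd].
apply: cvgM.
  exact: (cvg_comp _ _ (cf w) (@coord_continuous _ _ _ 0 i (f w))).
exact: (cvg_comp _ _ (cg w) (@coord_continuous _ _ _ 0 i (g w))).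
Qed.

Lemma continuous_dotl z : continuous (fun w => dot w z).
Proof.
apply: continuous_dot; first by move=> ?; exact: cvg_id.
exact: cst_continuous.
Qed.

End Dot.

Lemma dot_row_mx (R : realType) (m n : nat) (x y : 'rV[R]_m) (z w : 'rV[R]_n) :
  dot (row_mx x z) (row_mx y w) = dot x y + dot z w.
Proof.
rewrite /dot big_split_ord /=; congr (_ + _); apply: eq_bigr => i _.
  by rewrite !row_mxEl.
by rewrite !row_mxEr.
Qed.

(** Each strict inequality is an open condition, and finitely many neighbourhoods can be
    intersected. Below it keeps the strict signs near a point of the graph. *)
Lemma near_forall_lt0 (R : realType) (T : topologicalType) (I : finType)
    (J : set I) (g : I -> T -> R) (t0 : T) :
  (forall i, continuous (g i)) -> (forall i, J i -> g i t0 < 0) ->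
  \forall t \near t0, forall i, J i -> g i t < 0.
Proof.
move=> cg g0; apply: filter_forall => i.
case: (pselect (J i)) => [/g0 gi0|nJ]; last by apply: nearW => t /nJ.
by apply: filterS (cvgr_lt _ (cg i t0) _ gi0).
Qed.

(** * Fréchet normals: a necessary and a sufficient condition *)

Section FrechetNormal.
Context {R : realType} {m : nat} {Omega : set 'rV[R]_m} {w0 z : 'rV[R]_m}.

(** Along the ray the difference quotient is constantly [dot z d / enorm d]. The ray meets every
    neighbourhood of [w0] at points of [Omega] other than [w0], so a positive constant would
    contradict the bound on the limsup. *)
Lemma frechet_normal_feasible_dir (d : 'rV[R]_m) :
  (\forall t \near 0^'+, Omega (w0 + t *: d)) ->
  frechet_normal Omega w0 z -> dot z d <= 0.
Proof.
move=> Od; rewrite /frechet_normal /= /limf_esup => Nz; rewrite leNgt.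
apply/negP => zd_gt0.
have d0 : d != 0.
  by apply: contraTneq zd_gt0 => ->; rewrite dotC dot0l ltxx.
have nd := enorm_gt0 d0.
have c0 : 0 < dot z d / enorm d by rewrite divr_gt0.
have : (ereal_inf [set ereal_sup ((fun w => (dot z (w - w0) / enorm (w - w0))%:E)
   @` V) | V in within (Omega `\ w0) (nbhs w0)] < (dot z d / enorm d)%:E)%E.
  by apply: le_lt_trans Nz _; rewrite lte_fin.
move=> /ereal_inf_lt[_ [V Vw0 <-]] supV.
have cvgd : w0 + t *: d @[t --> 0^'+] --> w0.
  rewrite -[X in _ --> X](_ : w0 + 0 *: d = w0); last by rewrite scale0r addr0.
  apply: cvgD; first exact: cvg_cst.
  by apply: cvgZr_tmp; apply: cvg_at_right_filter; exact: cvg_id.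
have /filter_ex[t [[t0 Ot] Vt]] : \forall t \near 0^'+,
    (0 < t /\ Omega (w0 + t *: d)) /\
    ((Omega `\ w0) (w0 + t *: d) -> V (w0 + t *: d)).
  apply: filterI; last exact: cvgd Vw0.
  by apply: filterI => //; exact: nbhs_right_gt.
move: supV; apply/negP; rewrite -leNgt; apply: ereal_sup_ubound.
exists (w0 + t *: d); first apply: Vt.
  split=> //= /eqP; rewrite -subr_eq0 addrC addKr scaler_eq0 (negPf d0) orbF.
  by rewrite gt_eqF.
rewrite [w0 + _]addrC addrK dotZr enormZ ?ltW//; congr (_%:E).
by rewrite -mulf_div divff ?mul1r// gt_eqF.
Qed.

(** The half-space [V] belongs to the filter, and the quotient is nonpositive on it, so its supremum
    there already bounds the limsup. *)
Lemma frechet_normal_local :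
  (\forall w \near w0, Omega w -> dot z (w - w0) <= 0) ->
  frechet_normal Omega w0 z.
Proof.
move=> Oz; rewrite /frechet_normal /= /limf_esup.
pose V := [set w | dot z (w - w0) <= 0].
apply: le_trans (_ : ereal_sup ((fun w =>
  (dot z (w - w0) / enorm (w - w0))%:E) @` V) <= 0)%E.
  apply: ereal_inf_lbound; exists V => //.
  by apply: filterS Oz => w Ow [/Ow].
apply: ge_ereal_sup => _ [w Vw <-].
by rewrite lee_fin mulr_le0_ge0// invr_ge0 sqrtr_ge0.
Qed.

End FrechetNormal.

(** * Expansions in the dual bases [b] and [-u] *)

Section SimplicialCone.
Context (R : realType) (n : nat) (b u : 'I_n -> 'rV[R]_n).
Hypothesis hb : free [tuple b i | i < n].
Hypothesis hu : forall j i : 'I_n, dot (u j) (b i) = - (i == j)%:R.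
Implicit Types (v w x p q : 'rV[R]_n) (i j : 'I_n).

Lemma dot_sum_b (a : 'I_n -> R) (P : pred 'I_n) j :
  dot (\sum_(i | P i) a i *: b i) (u j) = if P j then - a j else 0.
Proof.
rewrite dot_suml (eq_bigr (fun i => if i == j then - a j else 0)).
  rewrite -big_mkcondr big_mkcond (bigD1 j)//= eqxx andbT big1 ?addr0// => i.
  by move/negPf ->; rewrite andbF.
by move=> i _; rewrite dotZl dotC hu; case: eqP => [->|_];
  rewrite ?mulrN1 ?oppr0 ?mulr0.
Qed.

Lemma dot_sum_u (a : 'I_n -> R) (P : pred 'I_n) j :
  dot (\sum_(i | P i) a i *: u i) (b j) = if P j then - a j else 0.
Proof.
rewrite dot_suml (eq_bigr (fun i => if i == j then - a j else 0)).
  rewrite -big_mkcondr big_mkcond (bigD1 j)//= eqxx andbT big1 ?addr0// => i.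
  by move/negPf ->; rewrite andbF.
by move=> i _; rewrite dotZl hu eq_sym; case: eqP => [->|_];
  rewrite ?mulrN1 ?oppr0 ?mulr0.
Qed.

(** A free family of [n] vectors spans the space; pairing with [u i] then reads off the coefficient,
    up to sign. *)
Lemma expand_b v : v = \sum_i (- dot v (u i)) *: b i.
Proof.
have /coord_span vE : v \in <<[tuple b i | i < n]>>%VS.
  suff -> : <<[tuple b i | i < n]>>%VS = fullv by rewrite memvf.
  apply/eqP; rewrite eqEdim subvf /= (eqP hb) size_tuple.
  by rewrite dimvf /dim /= mul1n.
set c := fun i => coord [tuple b i | i < n] i v.
have {}vE : v = \sum_i c i *: b i.
  by rewrite {1}vE; apply: eq_bigr => i _; rewrite -tnth_nth tnth_mktuple.
by rewrite {1}vE; apply: eq_bigr => i _; rewrite vE dot_sum_b opprK.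
Qed.

Lemma dot_dual v w : dot v w = - \sum_i dot v (u i) * dot w (b i).
Proof.
rewrite {1}[v]expand_b dot_suml -sumrN.
by apply: eq_bigr => i _; rewrite dotZl mulNr (dotC w).
Qed.

(** The difference of the two sides is orthogonal to every [b i], so [dot_dual] makes its square
    norm vanish. *)
Lemma expand_u v : v = \sum_i (- dot v (b i)) *: u i.
Proof.
apply/eqP; rewrite -subr_eq0; apply/eqP/dot_eq0; rewrite dot_dual.
rewrite big1 ?oppr0// => i _.
by rewrite [X in _ * X]dotBl dot_sum_u opprK subrr mulr0.
Qed.

(** * The metric projection as a complementarity problem *)

Lemma coneP q : cone b q <-> forall i, dot q (u i) <= 0.
Proof.
split=> [[a a0 ->] i|qu]; first by rewrite dot_sum_b oppr_le0.
by exists (fun i => - dot q (u i)) => [i|]; rewrite ?oppr_ge0//; exact: expand_b.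
Qed.

(** The optimality conditions of Moreau's decomposition, coordinate by coordinate: [p] lies in the
    cone, [x - p] in its polar, and the two are orthogonal. *)
Definition kkt x p := forall i,
  [/\ dot p (u i) <= 0, dot (x - p) (b i) <= 0
    & dot p (u i) * dot (x - p) (b i) = 0].

(** By [dot_dual] and the sign conditions, the cross term [dot (p - q) (x - p)] is nonnegative. The
    resulting Pythagorean inequality [pyth] gives both minimality and uniqueness of [p]. *)
Lemma kkt_proj x p : kkt x p -> proj (cone b) x = p.
Proof.
move=> kp.
have pyth q : cone b q -> dot (x - p) (x - p) + dot (p - q) (p - q)
    <= dot (x - q) (x - q).
  move=> /coneP qu.
  have -> : x - q = (p - q) + (x - p) by rewrite [RHS]addrC addrA subrK.
  have : 0 <= dot (p - q) (x - p).
    rewrite dot_dual -sumrN; apply: sumr_ge0 => i _.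
    rewrite dotBl; have [] := kp i; have := qu i; nra.
  rewrite (dotDl (p - q) (x - p)) !(dotDr (p - q) (x - p)).
  by rewrite (dotC (x - p) (p - q)); lra.
have Kp : cone b p by apply/coneP => i; have [] := kp i.
apply: xget_unique; rewrite /is_proj /=.
  split=> // q /pyth; rewrite ler_enorm; have := dot_ge0 (p - q); lra.
move=> q [Kq /(_ p Kp)]; rewrite ler_enorm => qp.
apply/eqP; rewrite eq_sym -subr_eq0; apply/eqP/dot_eq0/eqP.
by rewrite eq_le dot_ge0 andbT; have := pyth _ Kq; lra.
Qed.

(** A nearest point may be sought among the [q] at least as close to [x] as the origin; these form a
    closed bounded set, on which the distance attains its minimum. *)
Lemma cone_nearest x : exists2 p, cone b p &
  forall q, cone b q -> dot (x - p) (x - p) <= dot (x - q) (x - q).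
Proof.
pose f q := dot (x - q) (x - q).
have cf : continuous f.
  have cB : continuous (fun q => x - q).
    move=> q; exact: (@cvgB _ _ _ (nbhs q) (nbhs_filter q) (fun=> x) id x q
      (cvg_cst x) cvg_id).
  exact: continuous_dot.
pose A := [set q | cone b q] `&` [set q | f q <= f 0].
have A0 : A 0.
  by split => //=; apply/coneP => i; rewrite dot0l.
have clA : closed A.
  apply: closedI.
    have -> : [set q | cone b q] = \bigcap_(i in setT) [set q | dot q (u i) <= 0].
      by apply/seteqP; split=> q /= => [/coneP qu i _|qu]; [|apply/coneP => i];
        exact: qu.
    apply: closed_bigI => i _.
    apply: (@closed_comp _ _ (fun q => dot q (u i)) [set t | t <= 0]).
      by move=> q _; exact: continuous_dotl.
    exact: closed_le.
  apply: (@closed_comp _ _ f [set t | t <= f 0]); last exact: closed_le.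
  by move=> q _; exact: cf.
have cA : compact A.
  (* Each coordinate will satisfy [q_i^2 <= 4 * dot x x]; the added 1 turns this bound on the square
     into a bound on [|q_i|] without a square root. *)
  pose M := 4 * dot x x + 1.
  have cB := @rV_compact R n (fun=> `[(- M), M]%classic)
    (fun=> @segment_compact R (- M) M).
  apply: subclosed_compact clA cB _ => q [_ /= fq] i.
  have qq : dot q q <= 4 * dot x x.
    move: fq; rewrite /f subr0 !dotBl !dotBr (dotC q x) => fq.
    (* [|q|^2 <= 2 |x - q|^2 + 2 |x|^2] *)
    have := dot_ge0 (x + x - q).
    by rewrite !dotBl !dotBr !dotDl !dotDr (dotC q x); lra.
  have qi : q 0 i * q 0 i <= dot q q.
    rewrite /dot (bigD1 i)//= lerDl sumr_ge0// => j _.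
    by rewrite -expr2 sqr_ge0.
  by rewrite /= in_itv /=; apply/andP; rewrite /M; split; nra.
have [p pA pmin] := EVT_min_rV (ex_intro _ _ A0) cA
  (continuous_subspaceT cf).
exists p; first by move/set_mem: pA => [].
move=> q Kq; case: (leP (f q) (f 0)) => [fq|/ltW fq].
  by apply: pmin; rewrite inE.
by apply: le_trans fq; apply: pmin; rewrite inE.
Qed.

(** First-order optimality: a step [t] along [v] changes the squared distance by
    [t^2 * dot v v - 2 * t * c], which is negative for small [t] if [c > 0]. *)
Lemma cone_nearest_dir x p v (e : R) : 0 < e ->
  (forall q, cone b q -> dot (x - p) (x - p) <= dot (x - q) (x - q)) ->
  (forall t, 0 < t -> t <= e -> cone b (p + t *: v)) ->
  dot (x - p) v <= 0.
Proof.
move=> e0 pmin Kv; rewrite leNgt; apply/negP => c0.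
set c := dot (x - p) v in c0.
(* For [t <= s] the quadratic term is less than [t * c]; the 1 keeps the denominator positive even
   when [v = 0]. *)
pose s := c / (dot v v + 1).
have vv := dot_ge0 v.
have s0 : 0 < s by rewrite divr_gt0// ltr_wpDl.
have sE : s * (dot v v + 1) = c by rewrite /s divfK// gt_eqF// ltr_wpDl.
pose t := Num.min e s.
have t0 : 0 < t by rewrite lt_min e0.
have te : t <= e by rewrite ge_min lexx.
have ts : t <= s by rewrite ge_min lexx orbT.
have := pmin _ (Kv t t0 te).
rewrite opprD addrA (dotBl (x - p) (t *: v)) !(dotBr _ (t *: v)) !dotZl.
rewrite !dotZr (dotC v) -/c.
have tc : 0 < t * c by rewrite mulr_gt0.
have : t * (t * (dot v v + 1)) <= t * c.
  by rewrite ler_pM2l// -sE ler_pM2r// ltr_wpDl.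
have := mulr_gt0 t0 t0.
by lra.
Qed.

(** At a nearest point, the direction [b i] is always admissible and gives the sign of
    [dot (x - p) (b i)]. When [dot p (u i) < 0], the direction [- b i] is admissible up to length
    [- dot p (u i)] and gives the opposite sign, hence complementarity. *)
Lemma kkt_exists x : exists p, kkt x p.
Proof.
have [p Kp pmin] := cone_nearest x; exists p => i.
have /coneP pu := Kp.
have pb : dot (x - p) (b i) <= 0.
  apply: (cone_nearest_dir ltr01 pmin) => t t0 _; apply/coneP => j.
  rewrite dotDl dotZl (dotC (b i)) hu.
  by have := pu j; case: eqP => _ /=; lra.
split=> //; move: (pu i); rewrite le_eqVlt => /predU1P[->|pi0].
  by rewrite mul0r.
suff : dot (x - p) (- b i) <= 0.
  rewrite dotNr oppr_le0 => pb0.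
  have -> : dot (x - p) (b i) = 0 by apply/eqP; rewrite eq_le pb.
  by rewrite mulr0.
have e0 : 0 < - dot p (u i) by rewrite oppr_gt0.
apply: (cone_nearest_dir e0 pmin) => t t0 te; apply/coneP => j.
rewrite dotDl dotZl dotNl (dotC (b i)) hu opprK eq_sym.
by have := pu j; case: eqP => [->|_] /=; lra.
Qed.

Lemma kktP x p : kkt x p <-> proj (cone b) x = p.
Proof.
split; first exact: kkt_proj.
by have [p' kp'] := kkt_exists x; rewrite (kkt_proj kp') => <-.
Qed.

(** * Index sets as signs of the complementarity pair *)

Lemma decomp_proj x (I : {set 'I_n}) a be : is_decomp b u x I a be ->
  forall i, dot (proj (cone b) x) (u i) = (if i \in I then 0 else - a i) /\
  dot (x - proj (cone b) x) (b i) = (if i \in I then - be i else 0).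
Proof.
move=> [xE be0 a0].
set p := \sum_(i in ~: I) a i *: b i in xE.
have pu i : dot p (u i) = if i \in I then 0 else - a i.
  by rewrite dot_sum_b inE; case: (i \in I).
have qb i : dot (x - p) (b i) = if i \in I then - be i else 0.
  by rewrite {1}xE addrC addKr dot_sum_u.
(* The [b]-part of any decomposition solves the complementarity system, so it is the projection;
   this fixes [I] and the relevant coefficients. *)
suff /kkt_proj -> : kkt x p by [].
move=> i; rewrite pu qb; case: ifPn => iI.
  by rewrite mul0r lexx; split=> //; rewrite oppr_le0 ltW// be0.
by rewrite mulr0 lexx; split=> //; rewrite oppr_le0 a0.
Qed.

(** Complementarity removes the [b]-terms of the projection on [I]; outside [I] the [u]-terms of the
    residual vanish by the choice of [I]. *)
Lemma proj_decomp x (p := proj (cone b) x) :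
  is_decomp b u x [set j | dot (x - p) (b j) < 0]%SET
    (fun i => - dot p (u i)) (fun j => - dot (x - p) (b j)).
Proof.
have kp : kkt x p by apply/kktP.
split.
- rewrite -[LHS](subrK p) addrC; congr (_ + _).
    rewrite {1}[p]expand_b [RHS]big_mkcond; apply: eq_bigr => i _.
    rewrite !inE; case: ifPn => //; rewrite negbK => qi.
    have [_ _ /eqP] := kp i; rewrite mulf_eq0 (lt_eqF qi) orbF => /eqP ->.
    by rewrite oppr0 scale0r.
  rewrite {1}[x - p]expand_u [RHS]big_mkcond; apply: eq_bigr => i _.
  rewrite !inE; case: ifPn => // qi; have [_ qi0 _] := kp i.
  have -> : dot (x - p) (b i) = 0 by apply/eqP; rewrite eq_le qi0 leNgt.
  by rewrite oppr0 scale0r.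
- by move=> j; rewrite inE oppr_gt0.
- by move=> i _; rewrite oppr_ge0; have [] := kp i.
Qed.

Lemma idx_posE x i :
  idx_pos b u x i <-> dot (proj (cone b) x) (u i) < 0.
Proof.
split=> [[I [a [be [/decomp_proj/(_ i)[-> _] /negPf -> ai]]]]|pi].
  by rewrite oppr_lt0.
do 3 eexists; split; first exact: proj_decomp; last by rewrite oppr_gt0.
have /kktP/(_ i)[_ _ /eqP] := erefl (proj (cone b) x).
by rewrite mulf_eq0 (lt_eqF pi) /= inE => /eqP ->; rewrite ltxx.
Qed.

Lemma idx_negE x i :
  idx_neg b u x i <-> dot (x - proj (cone b) x) (b i) < 0.
Proof.
split=> [[I [a [be [d iI]]]]|qi].
  have [_ ->] := decomp_proj d i; have [_ be0 _] := d.
  by rewrite iI oppr_lt0 be0.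
by do 3 eexists; split; [exact: proj_decomp|rewrite inE].
Qed.

Lemma idx_zeroE x i : idx_zero b u x i <->
  dot (proj (cone b) x) (u i) = 0 /\ dot (x - proj (cone b) x) (b i) = 0.
Proof.
split=> [[I [a [be [/decomp_proj/(_ i)[-> ->] /negPf -> ->]]]]|[pi qi]].
  by rewrite oppr0.
do 3 eexists; split; first exact: proj_decomp.
  by rewrite inE qi ltxx.
by rewrite /= pi oppr0.
Qed.

(** * Segments in the graph and the coderivative *)

Lemma kkt_add_b x p i t : kkt x p -> dot p (u i) <= t ->
  dot (x - p) (b i) = 0 -> kkt (x + t *: b i) (p + t *: b i).
Proof.
move=> kp pt qi j.
(* The residual is unchanged, while only the [i]-th dual coordinate of [p] moves, by [- t]. It stays
   nonpositive for [t >= dot p (u i)], so negative [t] is allowed if that coordinate is negative. *)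
have -> : x + t *: b i - (p + t *: b i) = x - p.
  by rewrite [p + _]addrC addrKA.
rewrite dotDl dotZl (dotC (b i)) hu.
have [pj qj pq] := kp j; case: (i =P j) pj qj pq => [<-|_] /=.
  by rewrite qi mulrN1 !mulr0 subr_le0 lexx.
by rewrite mulr0n oppr0 mulr0 addr0.
Qed.

(** The dual counterpart: [p] is fixed and only the [i]-th coordinate of the residual moves, by
    [- t]. *)
Lemma kkt_add_u x p i t : kkt x p -> dot (x - p) (b i) <= t ->
  dot p (u i) = 0 -> kkt (x + t *: u i) p.
Proof.
move=> kp qt pi j; rewrite addrAC dotDl dotZl hu.
have [pj qj pq] := kp j; case: (j =P i) pj qj pq => [->|_] /=.
  by rewrite pi !mul0r mulrN1 subr_le0 lexx.
by rewrite mulr0n oppr0 mulr0 addr0.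
Qed.

Lemma coderivative_dir (f : 'rV[R]_n -> 'rV[R]_n) x y z d d' :
  (\forall t \near 0^'+, f (x + t *: d) = f x + t *: d') ->
  frechet_coderivative f x y z -> dot z d <= dot y d'.
Proof.
move=> fd /(@frechet_normal_feasible_dir _ _ _ _ _ (row_mx d d')).
rewrite dot_row_mx dotNl subr_le0; apply; apply: filterS fd => t ft.
by exists (x + t *: d) => //; rewrite ft scale_row_mx add_row_mx.
Qed.

(** The strict conditions are imposed on pairs in the product space, where [row_mx 0 (u i)] and
    [row_mx (b i) (- b i)] represent the linear functionals sending [(x, p)] to [dot p (u i)] and to
    [dot (x - p) (b i)]. They therefore persist on a neighbourhood. *)
Lemma coderivative_local (f : 'rV[R]_n -> 'rV[R]_n) x y z (J J' : set 'I_n) :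
  (forall i, J i -> dot (f x) (u i) < 0) ->
  (forall i, J' i -> dot (x - f x) (b i) < 0) ->
  (forall x',
    (forall i, J i -> dot (f x') (u i) < 0) ->
    (forall i, J' i -> dot (x' - f x') (b i) < 0) ->
    dot z (x' - x) <= dot y (f x' - f x)) ->
  frechet_coderivative f x y z.
Proof.
move=> fJ fJ' zy; apply: frechet_normal_local.
have {}fJ : \forall w \near row_mx x (f x), forall i, J i ->
    dot w (row_mx 0 (u i)) < 0.
  apply: near_forall_lt0 => [i|i /fJ]; first exact: continuous_dotl.
  by rewrite dot_row_mx (dotC x) dot0l add0r.
have {}fJ' : \forall w \near row_mx x (f x), forall i, J' i ->
    dot w (row_mx (b i) (- b i)) < 0.
  apply: near_forall_lt0 => [i|i /fJ']; first exact: continuous_dotl.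
  by rewrite dot_row_mx dotNr dotBl.
near=> w => -[x' _ wE]; rewrite -wE opp_row_mx add_row_mx dot_row_mx.
rewrite dotNl subr_le0; apply: zy => i Ji.
  have /(_ i Ji) : forall i, J i -> dot w (row_mx 0 (u i)) < 0 by near: w.
  by rewrite -wE dot_row_mx (dotC x') dot0l add0r.
have /(_ i Ji) : forall i, J' i -> dot w (row_mx (b i) (- b i)) < 0 by near: w.
by rewrite -wE dot_row_mx dotNr dotBl.
Unshelve. all: by end_near. Qed.

End SimplicialCone.

(** * The two inclusions of the coderivative formula *)

Unset Implicit Arguments.
Set Strict Implicit.

Theorem theorem3p6 (R : realType) (n : nat) (hn : (1 <= n)%N)
    (b u : 'I_n -> 'rV[R]_n)
    (hb : free [tuple b i | i < n])
    (hu : forall j i : 'I_n, dot (u j) (b i) = - (i == j)%:R)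
    (hK : isotone_projection (cone b))
    (xbar y : 'rV[R]_n) :
  frechet_coderivative (proj (cone b)) xbar y =
  [set z : 'rV[R]_n |
    [/\ forall i, idx_pos b u xbar i -> dot z (b i) = dot y (b i),
        forall i, idx_zero b u xbar i -> dot z (b i) <= dot y (b i),
        forall j, idx_zero b u xbar j -> dot z (u j) <= 0
      & forall j, idx_neg b u xbar j -> dot z (u j) = 0]].
Proof.
set K := cone b; set p := proj K xbar.
have kp : kkt b u xbar p by apply/(kktP hb hu).
apply/seteqP; split=> z /=.
  move=> zD.
  (* The scalar [s] is an orientation, used as 1 or -1: the side condition holds for small [t] with
     [s = 1] always, with [s = -1] only under strict negativity. Having both orientations turns the
     inequality into an equality. *)
  have b_dir i (s : R) : dot (xbar - p) (b i) = 0 ->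
      (\forall t \near 0^'+, dot p (u i) <= t * s) ->
      dot z (s *: b i) <= dot y (s *: b i).
    move=> qi pts; apply: coderivative_dir zD; apply: filterS pts => t pts.
    by rewrite !scalerA; apply/(kktP hb hu); exact: kkt_add_b.
  have u_dir i (s : R) : dot p (u i) = 0 ->
      (\forall t \near 0^'+, dot (xbar - p) (b i) <= t * s) ->
      dot z (s *: u i) <= 0.
    move=> pi qts; rewrite -(dot0l y) (dotC 0).
    apply: coderivative_dir zD; apply: filterS qts => t qts.
    by rewrite scalerA scaler0 addr0; apply/(kktP hb hu); exact: kkt_add_u.
  have near1 (c : R) : c <= 0 -> \forall t \near 0^'+, c <= t * 1.
    move=> c0; near=> t; rewrite mulr1; apply: le_trans c0 _; apply: ltW.
    by near: t; exact: nbhs_right_gt.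
  have nearN1 (c : R) : c < 0 -> \forall t \near 0^'+, c <= t * -1.
    move=> c0; near=> t; rewrite mulrN1 lerNr; near: t.
    by apply: nbhs_right_le; rewrite oppr_gt0.
  split=> i.
  - move=> /(idx_posE hb hu); rewrite -/K -/p => pi.
    have qi : dot (xbar - p) (b i) = 0.
      by have [_ _ /eqP] := kp i; rewrite mulf_eq0 (lt_eqF pi) => /eqP.
    have := b_dir i _ qi (near1 _ (ltW pi)).
    have := b_dir i _ qi (nearN1 _ pi).
    by rewrite !dotZr !mulN1r !mul1r lerN2 => zy yz; apply/le_anti/andP.
  - move=> /(idx_zeroE hb hu)[]; rewrite -/K -/p => pi qi.
    have [pi0 _ _] := kp i.
    by have := b_dir i _ qi (near1 _ pi0); rewrite scale1r.
  - move=> /(idx_zeroE hb hu)[]; rewrite -/K -/p => pi qi.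
    have [_ qi0 _] := kp i.
    by have := u_dir i _ pi (near1 _ qi0); rewrite scale1r.
  - move=> /(idx_negE hb hu); rewrite -/K -/p => qi.
    have pi : dot p (u i) = 0.
      by have [_ _ /eqP] := kp i; rewrite mulf_eq0 (lt_eqF qi) orbF => /eqP.
    have := u_dir i _ pi (near1 _ (ltW qi)).
    have := u_dir i _ pi (nearN1 _ qi).
    by rewrite !dotZr mulN1r mul1r oppr_le0 => zu uz; apply/le_anti/andP.
move=> [zpos zzero_b zzero_u zneg].
pose J := [set i | dot p (u i) < 0].
pose J' := [set i | dot (xbar - p) (b i) < 0].
apply: (@coderivative_local _ _ b u _ _ _ _ J J') => // x'.
rewrite -/K -/p; set p' := proj K x' => x'J x'J'.
have kp' : kkt b u x' p' by apply/(kktP hb hu).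
have -> : x' - xbar = (p' - p) + ((x' - p') - (xbar - p)).
  by apply/rowP => j; rewrite !mxE; lra.
suff : dot (p' - p) (z - y) <= 0 /\ dot z ((x' - p') - (xbar - p)) <= 0.
  by rewrite (dotBr z y) (dotDr (p' - p)) !(dotC (p' - p)) => -[]; lra.
(* Both inner products become negated sums over [i], so it suffices that every summand is
   nonnegative, case by case on the index set containing [i]. *)
rewrite !(dot_dual hb hu) !oppr_le0.
have sign i : [\/ dot p (u i) < 0, dot (xbar - p) (b i) < 0
    | dot p (u i) = 0 /\ dot (xbar - p) (b i) = 0].
  have [pi qi _] := kp i; move: pi qi; rewrite !le_eqVlt.
  by move=> /predU1P[pi|?] /predU1P[qi|?];
    [apply: Or33|apply: Or32|apply: Or31|apply: Or31].
split; apply: sumr_ge0 => i _; rewrite ?(dotBl p') ?(dotBl z y)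
    ?(dotBl (x' - p')); have [pi' qi' /eqP] := kp' i; rewrite mulf_eq0;
    case: (sign i) => [pi|qi|[pi qi]].
- by rewrite (zpos i) ?subrr ?mulr0//; apply/(idx_posE hb hu).
(* The residual coordinate is negative at [xbar] and at [x'], so complementarity makes the [i]-th
   coordinates of [p] and [p'] both zero. *)
- have [_ _ /eqP] := kp i; rewrite !mulf_eq0 (lt_eqF qi) (lt_eqF (x'J' i qi)).
  by rewrite !orbF => /eqP -> /eqP ->; rewrite subrr mul0r.
(* On the zero index set the increment is just the coordinate of [p'], which is nonpositive, and it
   multiplies another nonpositive factor. *)
- rewrite pi subr0 mulr_le0// subr_le0 zzero_b//.
  by apply/(idx_zeroE hb hu).
(* Symmetrically, negative coordinates of [p] and [p'] force both residual coordinates to vanish. *)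
- have [_ _ /eqP] := kp i; rewrite !mulf_eq0 (lt_eqF pi) (lt_eqF (x'J i pi)).
  by move=> /= /eqP -> /eqP ->; rewrite subrr mulr0.
- by rewrite (zneg i) ?mul0r//; apply/(idx_negE hb hu).
- rewrite qi subr0 mulr_le0// zzero_u//.
  by apply/(idx_zeroE hb hu).
Unshelve. all: by end_near. Qed.
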